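(* Let $n \ge 1$ and let $\mathbf{C}'(\mathbb{R}^n)$ be the set of non-empty compact subsets of $\mathbb{R}^n$ that are not reduced to a single point, equipped with the Hausdorff distance $d_H$. There is a convexity measure $f : \mathbf{C}'(\mathbb{R}^n) \to [0,1]$ which is continuous for the Hausdorff distance.
   Context: For non-empty compact $A, B \subset \mathbb{R}^n$, the Hausdorff distance is $d_H(A,B) = \max\{\sup_{a \in A} d(a,B),\ \sup_{b \in B} d(b,A)\}$, where $d$ is the Euclidean distance and $d(x,S) = \inf_{s \in S} d(x,s)$. A convexity measure on $\mathbf{C}'(\mathbb{R}^n)$ is a function $m : \mathbf{C}'(\mathbb{R}^n) \to \mathbb{R}$ such that: - (Standardisation 1) $m$ takes values in $[0,1]$; - (Standardisation 2) for all $A \in \mathbf{C}'(\mathbb{R}^n)$, $m(A) = 1$ if and only if $A$ is convex; - (Continuity) $m(A_k) \to m(A)$ whenever $A_k \to A$ in $\mathbf{C}'(\mathbb{R}^n)$ for $d_H$; - (Stability by similarities) $m(s(A)) = m(A)$ for every $A \in \mathbf{C}'(\mathbb{R}^n)$ and every similarity $s$ of $\mathbb{R}^n$ (a map $s : \mathbb{R}^n \to \mathbb{R}^n$ for which there is $\rho > 0$ with $d(s(x),s(y)) = \rho\, d(x,y)$ for all $x,y$); - (Proximity) there exists a sequence $(A_k)_k$ in $\mathbf{C}'(\mathbb{R}^n)$ such that $m(A_k) \to 0$ as $k \to \infty$. *)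

(* Defs.v *)
From HB Require Import structures.
From mathcomp Require Import all_boot all_order all_algebra.
From mathcomp Require Import ring lra.
From mathcomp Require Import all_classical all_reals all_analysis.

Set Implicit Arguments.
Unset Strict Implicit.
Unset Printing Implicit Defensive.

Import Order.TTheory GRing.Theory Num.Theory.
Import numFieldNormedType.Exports.

Local Open Scope classical_set_scope.
Local Open Scope ring_scope.

(* The canonical distance on 'rV[R]_n is the sup distance; the Euclidean one
   induces the same topology, so [compact] below is the usual notion. *)
Definition euclid_dist (R : realType) (n : nat) (x y : 'rV[R]_n) : R :=
  Num.sqrt (\sum_(i < n) (x 0 i - y 0 i) ^+ 2).

Definition dist_to_set (R : realType) (n : nat) (x : 'rV[R]_n)
    (S : set 'rV[R]_n) : R :=
  inf [set euclid_dist x s | s in S].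

Definition hausdorff_dist (R : realType) (n : nat) (A B : set 'rV[R]_n) : R :=
  Num.max (sup [set dist_to_set a B | a in A])
          (sup [set dist_to_set b A | b in B]).

(* C'(R^n); the Hausdorff metric on it is declared below with [isMetric]. *)
Record compacts' (R : realType) (n : nat) := Compacts' {
  compacts'_set :> set 'rV[R]_n ;
  compacts'_compact : compact compacts'_set ;
  compacts'_nonempty : compacts'_set !=set0 ;
  compacts'_not_singleton : forall x, compacts'_set <> [set x]
}.

Arguments compacts'_compact {R n} _.

Definition similarity (R : realType) (n : nat) (s : 'rV[R]_n -> 'rV[R]_n) :=
  exists2 rho : R, 0 < rho &
    forall x y, euclid_dist (s x) (s y) = rho * euclid_dist x y.

Section euclid_dist_theory.
Context (R : realType) (n : nat).
Implicit Types x y z : 'rV[R]_n.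

Lemma euclid_dist_ge0 x y : 0 <= euclid_dist x y.
Proof. exact: sqrtr_ge0. Qed.

Lemma euclid_distxx x : euclid_dist x x = 0.
Proof.
by rewrite /euclid_dist big1 ?sqrtr0// => i _; rewrite subrr expr0n.
Qed.

Lemma euclid_dist_sym x y : euclid_dist x y = euclid_dist y x.
Proof.
by congr Num.sqrt; apply: eq_bigr => i _; rewrite -sqrrN opprB.
Qed.

Lemma coord_le_euclid_dist x y i : `|x 0 i - y 0 i| <= euclid_dist x y.
Proof.
rewrite -sqrtr_sqr; apply: ler_wsqrtr; rewrite (bigD1 i)//= lerDl.
by apply: sumr_ge0 => j _; exact: sqr_ge0.
Qed.

Lemma euclid_dist_eq0 x y : euclid_dist x y = 0 -> x = y.
Proof.
move=> xy0; apply/rowP => i; apply/eqP; rewrite -subr_eq0 -normr_le0 -xy0.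
exact: coord_le_euclid_dist.
Qed.

Lemma sqr_euclid_dist x y :
  euclid_dist x y ^+ 2 = \sum_(i < n) (x 0 i - y 0 i) ^+ 2.
Proof. by rewrite sqr_sqrtr// sumr_ge0// => i _; exact: sqr_ge0. Qed.

Lemma euclid_dist_triangle y x z :
  euclid_dist x z <= euclid_dist x y + euclid_dist y z.
Proof.
set a := euclid_dist x y; set b := euclid_dist y z.
have a0 : 0 <= a by exact: euclid_dist_ge0.
have b0 : 0 <= b by exact: euclid_dist_ge0.
have [a_eq0|a_neq0] := eqVneq a 0.
  by rewrite a_eq0 add0r (euclid_dist_eq0 a_eq0).
have [b_eq0|b_neq0] := eqVneq b 0.
  by rewrite b_eq0 addr0 -(euclid_dist_eq0 b_eq0).
have ab0 : 0 < a * b by rewrite mulr_gt0// lt_neqAle eq_sym ?a_neq0 ?b_neq0.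
pose c := \sum_(i < n) (x 0 i - y 0 i) * (y 0 i - z 0 i).
have cab : c <= a * b.
  have : 0 <= \sum_(i < n) (b * (x 0 i - y 0 i) - a * (y 0 i - z 0 i)) ^+ 2.
    by apply: sumr_ge0 => i _; exact: sqr_ge0.
  have -> : \sum_(i < n) (b * (x 0 i - y 0 i) - a * (y 0 i - z 0 i)) ^+ 2 =
      b ^+ 2 * \sum_(i < n) (x 0 i - y 0 i) ^+ 2 +
      a ^+ 2 * \sum_(i < n) (y 0 i - z 0 i) ^+ 2 - (2 * a * b) * c.
    by rewrite !mulr_sumr -big_split/= -sumrB; apply: eq_bigr => i _; ring.
  rewrite -!sqr_euclid_dist -/a -/b => h; rewrite -(ler_pM2l ab0); lra.
rewrite -(ler_pXn2r (ltn0Sn 1)) ?nnegrE ?euclid_dist_ge0 ?addr_ge0//.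
have -> : euclid_dist x z ^+ 2 = a ^+ 2 + b ^+ 2 + 2 * c.
  rewrite !sqr_euclid_dist mulr_sumr -!big_split/=.
  by apply: eq_bigr => i _; ring.
by lra.
Qed.

Lemma euclid_dist_ltP x e : 0 < e ->
  exists2 d, 0 < d & forall y, ball x d y -> euclid_dist x y < e.
Proof.
move=> e0; have n0 : 0 < n.+1%:R :> R by [].
exists (e / n.+1%:R); first exact: divr_gt0.
move=> y [_ xy].
rewrite -(ltr_pXn2r (ltn0Sn 1)) ?nnegrE ?euclid_dist_ge0 ?ltW// sqr_euclid_dist.
apply: (@le_lt_trans _ _ (\sum_(i < n) (e / n.+1%:R) ^+ 2)).
  apply: ler_sum => i _; rewrite -real_normK ?num_real//.
  rewrite lerXn2r ?nnegrE//; first by rewrite divr_ge0// ltW.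
  by have := xy 0 i; rewrite -ball_normE /= => /ltW.
rewrite sumr_const card_ord -[ltLHS]mulr_natl expr_div_n.
rewrite mulrCA gtr_pMr ?exprn_gt0// ltr_pdivrMr ?exprn_gt0//.
rewrite mul1r expr2 (@lt_le_trans _ _ n.+1%:R)// ?ltr_nat//.
by rewrite ler_peMr// ler1n.
Qed.

End euclid_dist_theory.

Section hausdorff_dist_theory.
Context (R : realType) (n : nat).
Implicit Types (x y : 'rV[R]_n) (A B C : compacts' R n).

Let has_lbound_dist x (S : set 'rV[R]_n) :
  has_lbound [set euclid_dist x s | s in S].
Proof. by exists 0 => _ [s _ <-]; exact: euclid_dist_ge0. Qed.

Lemma dist_to_set_le x (S : set 'rV[R]_n) s :
  S s -> dist_to_set x S <= euclid_dist x s.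
Proof. by move=> Ss; apply: ge_inf => //; exists s. Qed.

Lemma dist_to_set_ge x A (e : R) :
  (forall s, compacts'_set A s -> e <= euclid_dist x s) -> e <= dist_to_set x A.
Proof.
move=> h; apply: lb_le_inf => [|_ [s As <-]]; last exact: h.
by have [s As] := compacts'_nonempty A; exists (euclid_dist x s), s.
Qed.

Lemma dist_to_set_ge0 x A : 0 <= dist_to_set x A.
Proof. by apply: dist_to_set_ge => s _; exact: euclid_dist_ge0. Qed.

Lemma dist_to_set_mem x A : compacts'_set A x -> dist_to_set x A = 0.
Proof.
move=> Ax; apply/eqP; rewrite eq_le dist_to_set_ge0 andbT.
by rewrite -(euclid_distxx x) dist_to_set_le.
Qed.

Lemma dist_to_set_eq0 x A : dist_to_set x A = 0 -> compacts'_set A x.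
Proof.
move=> xA0; have clA : closed A.
  exact: (compact_closed (@norm_hausdorff R _) (compacts'_compact A)).
apply: clA.
move=> U /nbhs_ballP[e /= e0 xeU].
have [|_ [a Aa <-]] := @inf_adherent _ [set euclid_dist x s | s in A] _ e0.
  split => //; have [s As] := compacts'_nonempty A.
  by exists (euclid_dist x s), s.
rewrite -/(dist_to_set x A) xA0 add0r => xae; exists a; split => //.
apply: xeU; split => // i j; rewrite ord1.
exact: le_lt_trans (coord_le_euclid_dist _ _ _) xae.
Qed.

Let has_ubound_dist A B : has_ubound [set dist_to_set a B | a in A].
Proof.
have [M [Mreal MA]] := compact_bounded (compacts'_compact A).
have [b Bb] := compacts'_nonempty B.
pose N := `|M| + 1.
exists (\sum_(i < n) N ^+ 2 + 1 + euclid_dist 0 b) => _ [a Aa <-].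
apply: (le_trans (dist_to_set_le _ Bb)).
apply: (le_trans (euclid_dist_triangle 0 a b)); rewrite lerD2r.
have h : euclid_dist a 0 ^+ 2 <= \sum_(i < n) N ^+ 2.
  rewrite sqr_euclid_dist; apply: ler_sum => i _.
  rewrite mxE subr0 -real_normK ?num_real// lerXn2r ?nnegrE//.
    by rewrite addr_ge0.
  have aN : `|a| <= N.
    by apply: MA => //; rewrite (le_lt_trans (ler_norm M))// ltrDl.
  apply: le_trans aN; rewrite [leRHS]mx_normE.
  exact: (le_bigmax _ (fun ij => `|a ij.1 ij.2|%:nng) (0, i)).
have := euclid_dist_ge0 a 0; have := sqr_ge0 (euclid_dist a 0 - 1).
by rewrite sqrrB; nra.
Qed.

Let hausdorff_distC A B : hausdorff_dist A B = hausdorff_dist B A.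
Proof. exact: maxC. Qed.

Lemma dist_to_set_le_hausdorff A B a :
  compacts'_set A a -> dist_to_set a B <= hausdorff_dist A B.
Proof.
move=> Aa; rewrite le_max; apply/orP; left.
by apply: ub_le_sup => //; exists a.
Qed.

Lemma hausdorff_dist_le A B (e : R) :
  (forall a, compacts'_set A a -> dist_to_set a B <= e) ->
  (forall b, compacts'_set B b -> dist_to_set b A <= e) -> hausdorff_dist A B <= e.
Proof.
move=> AB BA; rewrite ge_max; apply/andP; split; apply: ge_sup.
- by have [a Aa] := compacts'_nonempty A; exists (dist_to_set a B), a.
- by move=> _ [a Aa <-]; exact: AB.
- by have [b Bb] := compacts'_nonempty B; exists (dist_to_set b A), b.
- by move=> _ [b Bb <-]; exact: BA.
Qed.

Lemma compacts'_eq A B : (A : set _) = B -> A = B.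
Proof.
case: A B => [A cA A0 A1] [B cB B0 B1]/= AB; case: _ / AB in cB B0 B1 *.
by congr Compacts'; exact: Prop_irrelevance.
Qed.

Lemma hausdorff_distxx A : hausdorff_dist A A = 0.
Proof.
apply/eqP; rewrite eq_le; apply/andP; split.
  by apply: hausdorff_dist_le => a Aa; rewrite dist_to_set_mem.
have [a Aa] := compacts'_nonempty A.
exact: le_trans (dist_to_set_ge0 _ _) (dist_to_set_le_hausdorff A Aa).
Qed.

Lemma hausdorff_dist_eq0 A B : hausdorff_dist A B = 0 -> A = B.
Proof.
move=> AB0; apply: compacts'_eq; apply/seteqP; split => x Xx.
  apply: dist_to_set_eq0; apply/eqP; rewrite eq_le dist_to_set_ge0 andbT.
  by rewrite -AB0; exact: dist_to_set_le_hausdorff.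
apply: dist_to_set_eq0; apply/eqP; rewrite eq_le dist_to_set_ge0 andbT.
by rewrite -AB0 hausdorff_distC; exact: dist_to_set_le_hausdorff.
Qed.

Lemma dist_to_set_triangle A B x :
  dist_to_set x B <= dist_to_set x A + hausdorff_dist A B.
Proof.
rewrite -lerBlDr; apply: dist_to_set_ge => a Aa; rewrite lerBlDr.
rewrite -lerBlDl.
apply: le_trans (dist_to_set_le_hausdorff B Aa).
apply: dist_to_set_ge => b Bb; rewrite lerBlDl.
exact: le_trans (dist_to_set_le x Bb) (euclid_dist_triangle a x b).
Qed.

Lemma hausdorff_dist_triangle B A C :
  hausdorff_dist A C <= hausdorff_dist A B + hausdorff_dist B C.
Proof.
apply: hausdorff_dist_le => [a Aa|c Cc].
  apply: le_trans (dist_to_set_triangle B C a) _.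
  by rewrite lerD2r dist_to_set_le_hausdorff.
apply: le_trans (dist_to_set_triangle B A c) _.
by rewrite addrC (hausdorff_distC A) (hausdorff_distC B C) lerD2l
  dist_to_set_le_hausdorff.
Qed.

HB.instance Definition _ := gen_eqMixin (compacts' R n).
HB.instance Definition _ := gen_choiceMixin (compacts' R n).
HB.instance Definition _ := @isMetric.Build R (compacts' R n)
  (fun A B => hausdorff_dist A B) hausdorff_distxx hausdorff_dist_eq0
  hausdorff_distC hausdorff_dist_triangle.

End hausdorff_dist_theory.

Section similarity_image.
Context (R : realType) (n : nat) (s : 'rV[R]_n -> 'rV[R]_n).
Hypothesis sim_s : similarity s.
Variable A : compacts' R n.

Lemma similarity_inj : injective s.
Proof.
have [rho rho0 srho] := sim_s => x y sxy.
apply: euclid_dist_eq0; apply/eqP; rewrite -(mulrI_eq0 _ (mulfI (lt0r_neq0 rho0))).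
by rewrite -srho sxy euclid_distxx.
Qed.

Lemma similarity_continuous : continuous s.
Proof.
have [rho rho0 srho] := sim_s => x U /nbhs_ballP[e /= e0 sxU].
have [d d0 xd] := euclid_dist_ltP x (divr_gt0 e0 rho0).
apply/nbhs_ballP; exists d => //= y /xd xye; apply: sxU; split => // i j; rewrite ord1.
apply: le_lt_trans (coord_le_euclid_dist _ _ _) _.
by rewrite srho mulrC -ltr_pdivlMr.
Qed.

Let image_compact : compact (s @` A).
Proof.
apply: continuous_compact (compacts'_compact A).
exact/continuous_subspaceT/similarity_continuous.
Qed.

Let image_nonempty : (s @` A) !=set0.
Proof. by have [a Aa] := compacts'_nonempty A; exists (s a), a. Qed.

Let image_not_singleton x : s @` A <> [set x].
Proof.
move=> sAx; have [a Aa] := compacts'_nonempty A.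
have sE b : compacts'_set A b -> s b = x.
  by move=> Ab; rewrite -[_ = _]/([set x] (s b)) -sAx; exists b.
apply: (@compacts'_not_singleton _ _ A a).
apply/seteqP; split => [b Ab|_ ->//].
by apply: similarity_inj; rewrite !sE.
Qed.

(* s(A), as an element of C'(R^n). *)
Definition similarity_image : compacts' R n :=
  Compacts' image_compact image_nonempty image_not_singleton.

End similarity_image.

Record convexity_measure (R : realType) (n : nat) (m : compacts' R n -> R) :
    Prop := ConvexityMeasure {
  standardisation1 : forall A, 0 <= m A <= 1 ;
  standardisation2 : forall A, m A = 1 <-> convex_set A ;
  continuity : forall (A_ : nat -> compacts' R n) (A : compacts' R n),
    A_ k @[k --> \oo] --> A -> m (A_ k) @[k --> \oo] --> m A ;
  stability_similarities : forall s (sim_s : similarity s) A,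
    m (similarity_image sim_s A) = m A ;
  proximity : exists A_ : nat -> compacts' R n, m (A_ k) @[k --> \oo] --> 0
}.

(* Main.v *)
Require Import Defs.
From mathcomp Require Import all_boot all_order all_algebra.
From mathcomp Require Import ring lra.
From mathcomp Require Import all_classical all_reals all_analysis.
Import Order.TTheory GRing.Theory Num.Theory.
Import numFieldNormedType.Exports.
Local Open Scope ring_scope.

(** For a compact set [A] let [defect A] be the supremum of the distances to [A] of
    the points on segments with both ends in [A].  Since [A] is closed, [defect A]
    vanishes exactly when [A] is convex.  Both [defect] and the diameter are
    Lipschitz for the Hausdorff distance, and a similarity of ratio [rho]
    multiplies both by [rho].  Hence the quotient [nonconvexity A] of [defect A]
    by [diam A] is continuous and similarity invariant; it lies in [[0, 1]]
    because a point of a segment is no farther from an end than the other end.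

    To meet the proximity axiom, divide by the supremum [S] of [nonconvexity]
    over all sets: [1 - nonconvexity A / S] is a convexity measure, and its
    values tend to [0] along any maximising sequence.  This uses [S > 0], that
    is, the existence of a set that is not convex, such as a set of two points;
    such a set requires dimension at least one. *)

(** * Points of a segment *)

Section Barycenter.
Context {R : realType} {n : nat}.
Implicit Types (x y p : 'rV[R]_n) (t : R).

Definition barycenter t x y : 'rV[R]_n := t *: x + (1 - t) *: y.

(** Stewart's theorem.  It expresses the distance to a point of a segment
    through distances to the ends, so that maps which scale distances are seen
    to preserve barycenters without first being shown affine. *)
Lemma stewart t x y p :
  euclid_dist p (barycenter t x y) ^+ 2 =
  t * euclid_dist p x ^+ 2 + (1 - t) * euclid_dist p y ^+ 2
  - t * (1 - t) * euclid_dist x y ^+ 2.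
Proof.
rewrite !sqr_euclid_dist !mulr_sumr -big_split/= -sumrB.
by apply: eq_bigr => i _; rewrite !mxE; ring.
Qed.

Lemma similarity_barycenter (s : 'rV[R]_n -> 'rV[R]_n) t x y :
  similarity s -> s (barycenter t x y) = barycenter t (s x) (s y).
Proof.
move=> [rho _ srho]; set z := barycenter t x y.
apply: euclid_dist_eq0; apply/eqP; rewrite -sqrf_eq0 stewart !srho.
(* Up to the factor [rho ^+ 2], what remains is Stewart's formula for the
   distance from [z] to itself. *)
have := stewart t x y z; rewrite -/z euclid_distxx [0 ^+ 2]expr2 mul0r => zE.
by apply/eqP; rewrite -(mulr0 (rho ^+ 2)) [in RHS]zE; ring.
Qed.

Lemma barycenter_dist_end t x y : 0 <= t <= 1 ->
  euclid_dist (barycenter t x y) x <= euclid_dist x y.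
Proof.
move=> /andP[t0 t1].
rewrite euclid_dist_sym -(ler_pXn2r (ltn0Sn 1)) ?nnegrE ?euclid_dist_ge0//.
rewrite stewart euclid_distxx [0 ^+ 2]expr2 mul0r.
by have := sqr_ge0 (euclid_dist x y); nra.
Qed.

(** The factor [2] comes from [(a + b)^2 <= 2 a^2 + 2 b^2] in each coordinate;
    any constant would serve for a Lipschitz estimate. *)
Lemma barycenter_dist t x y x' y' e : 0 <= t <= 1 ->
  euclid_dist x x' <= e -> euclid_dist y y' <= e ->
  euclid_dist (barycenter t x y) (barycenter t x' y') <= 2 * e.
Proof.
move=> /andP[t0 t1] xx' yy'.
have e0 : 0 <= e := le_trans (euclid_dist_ge0 _ _) xx'.
rewrite -(ler_pXn2r (ltn0Sn 1)) ?nnegrE ?euclid_dist_ge0 ?mulr_ge0//.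
apply: (@le_trans _ _ (2 * euclid_dist x x' ^+ 2 + 2 * euclid_dist y y' ^+ 2)).
  rewrite !sqr_euclid_dist !mulr_sumr -big_split/=; apply: ler_sum => i _.
  rewrite !mxE; set u := x 0 i; set u' := x' 0 i; set v := y 0 i.
  set v' := y' 0 i.
  have -> : t * u + (1 - t) * v - (t * u' + (1 - t) * v') =
    t * (u - u') + (1 - t) * (v - v') by ring.
  have := sqr_ge0 (t * (u - u') - (1 - t) * (v - v')).
  have := sqr_ge0 (u - u'); have := sqr_ge0 (v - v').
  move: (u - u') (v - v') => a b b2 a2 ab2.
  have : 0 <= (1 - t ^+ 2) * a ^+ 2 by apply: mulr_ge0 => //; nra.
  have : 0 <= (1 - (1 - t) ^+ 2) * b ^+ 2 by apply: mulr_ge0 => //; nra.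
  nra.
have := euclid_dist_ge0 x x'; have := euclid_dist_ge0 y y'; nra.
Qed.

End Barycenter.

(** * Diameter and distance to a set *)

Section DiameterDefect.
Set Implicit Arguments.
Unset Strict Implicit.
Context {R : realType} {n : nat}.
Implicit Types (A B : compacts' R n) (x y : 'rV[R]_n) (t e : R).

Definition diam A : R :=
  sup [set r | exists x y, [/\ compacts'_set A x, compacts'_set A y &
                              r = euclid_dist x y]].

Definition defect A : R :=
  sup [set r | exists t x y, [/\ 0 <= t <= 1, compacts'_set A x,
    compacts'_set A y & r = dist_to_set (barycenter t x y) A]].

Lemma diam_le A e :
  (forall x y, compacts'_set A x -> compacts'_set A y -> euclid_dist x y <= e) ->
  diam A <= e.
Proof.
move=> h; apply: ge_sup.
  by have [x Ax] := compacts'_nonempty A; exists (euclid_dist x x), x, x.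
by move=> _ [x [y [Ax Ay ->]]]; exact: h.
Qed.

Lemma diam_ge A x y : compacts'_set A x -> compacts'_set A y ->
  euclid_dist x y <= diam A.
Proof.
move=> Ax Ay; apply: ub_le_sup; last by exists x, y.
have [M [Mreal MA]] := compact_bounded (compacts'_compact A).
pose N := `|M| + 1.
have coordN z i : compacts'_set A z -> `|z 0 i| <= N.
  move=> Az; have zN : `|z| <= N.
    by apply: MA => //; rewrite (le_lt_trans (ler_norm M))// ltrDl.
  apply: le_trans zN; rewrite [leRHS]mx_normE.
  exact: (le_bigmax _ (fun ij => `|z ij.1 ij.2|%:nng) (0, i)).
exists (Num.sqrt (\sum_(i < n) (2 * N) ^+ 2)) => _ [a [b [Aa Ab ->]]].
apply: ler_wsqrtr; apply: ler_sum => i _.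
rewrite -real_normK ?num_real// lerXn2r ?nnegrE//.
  by rewrite mulr_ge0// addr_ge0.
rewrite (le_trans (ler_normB _ _))// mulrDl mul1r lerD//; exact: coordN.
Qed.

Lemma diam_gt0 A : 0 < diam A.
Proof.
have [x Ax] := compacts'_nonempty A.
rewrite lt_neqAle; apply/andP; split; last first.
  exact: le_trans (euclid_dist_ge0 x x) (diam_ge Ax Ax).
apply/eqP => d0; apply: (@compacts'_not_singleton _ _ A x).
apply/seteqP; split => [y Ay|_ ->//].
apply: euclid_dist_eq0; apply/eqP; rewrite eq_le euclid_dist_ge0 andbT.
by rewrite d0 diam_ge.
Qed.

Lemma defect_le A e :
  (forall t x y, 0 <= t <= 1 -> compacts'_set A x -> compacts'_set A y ->
    dist_to_set (barycenter t x y) A <= e) ->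
  defect A <= e.
Proof.
move=> h; apply: ge_sup; last by move=> _ [t [x [y [t01 Ax Ay ->]]]]; exact: h.
have [x Ax] := compacts'_nonempty A.
by exists (dist_to_set (barycenter 0 x x) A), 0, x, x; rewrite lexx ler01.
Qed.

Lemma barycenter_dist_le_diam A t x y :
  0 <= t <= 1 -> compacts'_set A x -> compacts'_set A y ->
  dist_to_set (barycenter t x y) A <= diam A.
Proof.
move=> t01 Ax Ay; apply: le_trans (dist_to_set_le _ Ax) _.
by apply: le_trans (barycenter_dist_end _ _ _ t01) _; exact: diam_ge.
Qed.

Lemma defect_ge A t x y :
  0 <= t <= 1 -> compacts'_set A x -> compacts'_set A y ->
  dist_to_set (barycenter t x y) A <= defect A.
Proof.
move=> t01 Ax Ay; apply: ub_le_sup; last by exists t, x, y.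
by exists (diam A) => _ [u [a [b [u01 Aa Ab ->]]]]; exact: barycenter_dist_le_diam.
Qed.

Lemma defect_le_diam A : defect A <= diam A.
Proof. by apply: defect_le => t x y; exact: barycenter_dist_le_diam. Qed.

Lemma defect_ge0 A : 0 <= defect A.
Proof.
have [x Ax] := compacts'_nonempty A.
apply: le_trans (dist_to_set_ge0 (barycenter 0 x x) A) _.
by apply: defect_ge => //; rewrite lexx ler01.
Qed.

(** A distance zero to [A] means membership because [A] is closed. *)
Lemma defect_eq0P A : defect A = 0 <-> convex_set (compacts'_set A).
Proof.
split=> [d0 x y t|cA].
  rewrite !inE => Ax Ay; apply: dist_to_set_eq0; apply/eqP.
  rewrite eq_le dist_to_set_ge0 andbT -d0.
  by apply: (@defect_ge A t%:inum) => //; apply/andP; split.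
apply/eqP; rewrite eq_le defect_ge0 andbT; apply: defect_le => t x y t01 Ax Ay.
have [t0 t1] := andP t01.
have := cA x y (Itv01 t0 t1); rewrite !inE => /(_ Ax Ay) Az.
by rewrite dist_to_set_mem.
Qed.

(** * Continuity for the Hausdorff distance *)

(** The infimum defining the distance to [B] is only approached, whence the
    strict bound [e]. *)
Lemma hausdorff_approx A B e x : hausdorff_dist A B < e -> compacts'_set A x ->
  exists2 y, compacts'_set B y & euclid_dist x y <= e.
Proof.
move=> ABe Ax.
have xBe := le_lt_trans (dist_to_set_le_hausdorff B Ax) ABe.
have e0 : 0 < e - dist_to_set x B by rewrite subr_gt0.
have [|_ [y By <-] xy] :=
    @inf_adherent _ [set euclid_dist x s | s in B]%classic _ e0.
  split; last by exists 0 => _ [s _ <-]; exact: euclid_dist_ge0.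
  by have [s Bs] := compacts'_nonempty B; exists (euclid_dist x s), s.
exists y => //; apply: ltW; move: xy; rewrite -/(dist_to_set x B); lra.
Qed.

Lemma lipschitz_compacts'_continuous (g : compacts' R n -> R) (k : R) :
  (forall A B e, hausdorff_dist A B < e -> g A <= g B + k * e) -> continuous g.
Proof.
move=> glip A; apply/(@cvgrPdist_le _ _ _ (nbhs A)) => e e0.
pose d := e / (`|k| + 1).
have k0 : 0 < `|k| + 1 by rewrite ltr_pwDr.
have d0 : 0 < d by rewrite divr_gt0.
have kd : k * d <= e.
  rewrite /d mulrA ler_pdivrMr// mulrC ler_pM2l//.
  by rewrite (le_trans (ler_norm k))// lerDl.
apply/nbhs_ballP; exists d => //= B AB.
have dAB : hausdorff_dist A B < d by exact: AB.
have dBA : hausdorff_dist B A < d by rewrite /hausdorff_dist maxC.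
have := glip _ _ _ dAB; have := glip _ _ _ dBA.
rewrite ler_norml; lra.
Qed.

Lemma diam_continuous : continuous diam.
Proof.
apply: (@lipschitz_compacts'_continuous _ 2) => A B e ABe.
apply: diam_le => x y Ax Ay.
have [x' Bx' xx'] := hausdorff_approx ABe Ax.
have [y' By' yy'] := hausdorff_approx ABe Ay.
have := euclid_dist_triangle x' x y; have := euclid_dist_triangle y' x' y.
by have := diam_ge Bx' By'; rewrite (euclid_dist_sym y' y); lra.
Qed.

Lemma defect_continuous : continuous defect.
Proof.
apply: (@lipschitz_compacts'_continuous _ 3) => A B e ABe.
apply: defect_le => t x y t01 Ax Ay.
have [x' Bx' xx'] := hausdorff_approx ABe Ax.
have [y' By' yy'] := hausdorff_approx ABe Ay.
have BAe : hausdorff_dist B A < e by rewrite /hausdorff_dist maxC.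
(* The point [z] is moved to [z'], then to some [b] near [z'] in [B], and from
   [b] back to [A]. *)
set z := barycenter t x y; pose z' := barycenter t x' y'.
have zz' : euclid_dist z z' <= 2 * e by exact: barycenter_dist.
have z'A := dist_to_set_triangle B A z'.
have z'B : dist_to_set z' B <= defect B by exact: defect_ge.
suff : dist_to_set z A <= euclid_dist z z' + dist_to_set z' A by lra.
rewrite -lerBlDl; apply: dist_to_set_ge => a Aa; rewrite lerBlDl.
exact: le_trans (dist_to_set_le z Aa) (euclid_dist_triangle z' z a).
Qed.

(** * Behaviour under similarities *)

Section Similarity.
Variables (s : 'rV[R]_n -> 'rV[R]_n) (sim_s : similarity s) (rho : R).
Hypotheses (rho0 : 0 < rho)
  (srho : forall x y, euclid_dist (s x) (s y) = rho * euclid_dist x y).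

Lemma dist_to_set_similarity x A :
  dist_to_set (s x) (similarity_image sim_s A) = rho * dist_to_set x A.
Proof.
apply/eqP; rewrite eq_le; apply/andP; split.
  rewrite -ler_pdivrMl//; apply: dist_to_set_ge => a Aa.
  by rewrite ler_pdivrMl// -srho; apply: dist_to_set_le; exists a.
apply: dist_to_set_ge => _ [a Aa <-].
by rewrite srho ler_pM2l// dist_to_set_le.
Qed.

Lemma diam_similarity A : diam (similarity_image sim_s A) = rho * diam A.
Proof.
apply/eqP; rewrite eq_le; apply/andP; split.
  apply: diam_le => _ _ [x Ax <-] [y Ay <-].
  by rewrite srho ler_pM2l// diam_ge.
rewrite -ler_pdivlMl//; apply: diam_le => x y Ax Ay.
by rewrite ler_pdivlMl// -srho diam_ge//; [exists x|exists y].
Qed.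

Lemma defect_similarity A : defect (similarity_image sim_s A) = rho * defect A.
Proof.
apply/eqP; rewrite eq_le; apply/andP; split.
  apply: defect_le => t _ _ t01 [x Ax <-] [y Ay <-].
  rewrite -similarity_barycenter// dist_to_set_similarity ler_pM2l//.
  exact: defect_ge.
rewrite -ler_pdivlMl//; apply: defect_le => t x y t01 Ax Ay.
rewrite ler_pdivlMl// -dist_to_set_similarity similarity_barycenter//.
by apply: defect_ge => //; [exists x|exists y].
Qed.

End Similarity.

(** * The normalised defect *)

Definition nonconvexity A : R := defect A / diam A.

Lemma nonconvexity_ge0 A : 0 <= nonconvexity A.
Proof. by rewrite divr_ge0 ?defect_ge0// ltW// diam_gt0. Qed.

Lemma nonconvexity_le1 A : nonconvexity A <= 1.
Proof. by rewrite ler_pdivrMr ?diam_gt0// mul1r defect_le_diam. Qed.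

Lemma nonconvexity_eq0P A :
  nonconvexity A = 0 <-> convex_set (compacts'_set A).
Proof.
rewrite -defect_eq0P; split=> [/eqP|d0]; last by rewrite /nonconvexity d0 mul0r.
by rewrite mulf_eq0 invr_eq0 (gt_eqF (diam_gt0 A)) orbF => /eqP.
Qed.

Lemma nonconvexity_continuous : continuous nonconvexity.
Proof.
move=> A; apply: (@cvgM _ _ (nbhs A)); first exact: defect_continuous.
apply: (@cvgV _ _ (nbhs A)); last exact: diam_continuous.
by rewrite gt_eqF// diam_gt0.
Qed.

Lemma nonconvexity_similarity s (sim_s : similarity s) A :
  nonconvexity (similarity_image sim_s A) = nonconvexity A.
Proof.
have [rho rho0 srho] := sim_s.
rewrite /nonconvexity (defect_similarity _ rho0 srho) (diam_similarity _ rho0 srho).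
by rewrite -mulf_div divff ?mul1r// gt_eqF.
Qed.

Lemma exists_nonconvex : (0 < n)%N ->
  exists A : compacts' R n, ~ convex_set (compacts'_set A).
Proof.
move=> n0; pose i0 := Ordinal n0.
pose P : set 'rV[R]_n := [set 0; const_mx 1]%classic.
have coord0 (c : R) (v : 'rV[R]_n) : const_mx c = v -> c = v 0 i0.
  by move=> <-; rewrite mxE.
have cP : compact P by apply: compactU; exact: compact_set1.
have P0 : P (0 : 'rV[R]_n) by left.
have P1 : P (const_mx 1 : 'rV[R]_n) by right.
have PN0 : (P !=set0)%classic by exists 0.
have Pns v : P <> [set v]%classic.
  move=> Pv; move: P0 P1; rewrite Pv /= => <- /coord0.
  by rewrite mxE => /eqP; rewrite oner_eq0.
exists (Compacts' cP PN0 Pns) => /defect_eq0P d0.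
(* The midpoint of the two points is neither of them. *)
pose h : 'rV[R]_n := barycenter 2^-1 0 (const_mx 1).
have : P h.
  apply: (@dist_to_set_eq0 _ _ h (Compacts' cP PN0 Pns)).
  apply/eqP; rewrite eq_le dist_to_set_ge0 andbT -d0.
  by apply: defect_ge => //; lra.
by case=> /rowP/(_ i0); rewrite /h !mxE; lra.
Qed.

Definition sup_nonconvexity : R := sup (range nonconvexity).

Lemma nonconvexity_le_sup A : nonconvexity A <= sup_nonconvexity.
Proof.
apply: ub_le_sup; last by exists A.
by exists 1 => _ [B _ <-]; exact: nonconvexity_le1.
Qed.

Lemma sup_nonconvexity_gt0 : (0 < n)%N -> 0 < sup_nonconvexity.
Proof.
move=> n0; have [A ncA] := exists_nonconvex n0.
apply: lt_le_trans (nonconvexity_le_sup A).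
rewrite lt_neqAle nonconvexity_ge0 andbT; apply/eqP => /esym.
by move=> /nonconvexity_eq0P.
Qed.

(** Approximate maximisers suffice for the proximity axiom; an exact one would
    call for Blaschke's selection theorem. *)
Lemma sup_nonconvexity_approx e : (0 < n)%N -> 0 < e ->
  exists A, sup_nonconvexity - e < nonconvexity A.
Proof.
move=> n0 e0; have [|_ [A _ <-] lt_eA] := @sup_adherent _ (range nonconvexity) _ e0.
  split; first by have [A _] := exists_nonconvex n0; exists (nonconvexity A), A.
  by exists 1 => _ [B _ <-]; exact: nonconvexity_le1.
by exists A.
Qed.

End DiameterDefect.

Theorem mainTheorem2 (R : realType) (n : nat) (hn : (1 <= n)%N) :
  exists f : compacts' R n -> R, convexity_measure f /\ continuous f.
Proof.
pose S : R := @sup_nonconvexity R n.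
have S0 : 0 < S by exact: sup_nonconvexity_gt0.
pose f (A : compacts' R n) := 1 - nonconvexity A / S.
have fcont : continuous f.
  move=> A; apply: (@cvgB _ _ _ (nbhs A)); first exact: cvg_cst.
  by apply: (@cvgM _ _ (nbhs A)); [exact: nonconvexity_continuous|exact: cvg_cst].
have f01 A : 0 <= f A <= 1.
  rewrite /f lerBlDr lerDl divr_ge0 ?nonconvexity_ge0 ?(ltW S0)// andbT.
  by rewrite subr_ge0 ler_pdivrMr// mul1r nonconvexity_le_sup.
exists f; split=> //; split=> //.
- move=> A; rewrite -nonconvexity_eq0P /f; split=> [|->].
    move=> f1; have /eqP : nonconvexity A / S = 0 by lra.
    by rewrite mulf_eq0 invr_eq0 (gt_eqF S0) orbF => /eqP.
  by rewrite mul0r subr0.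
- move=> A_ A AA; exact: continuous_cvg (fcont A) AA.
- by move=> s sim_s A; rewrite /f nonconvexity_similarity.
- (* [f A_k <= 1 / (k + 1)] amounts to [S - S / (k + 1) <= nonconvexity A_k]. *)
  have approx k : exists A : compacts' R n, S - S * k.+1%:R^-1 < nonconvexity A.
    by apply: sup_nonconvexity_approx => //; rewrite mulr_gt0// invr_gt0.
  have [A_ A_P] := choice approx; exists A_.
  apply: squeeze_cvgr (cvg_cst 0) cvg_harmonic.
  apply: nearW => k; have /andP[-> _] := f01 (A_ k); rewrite /=.
  rewrite /f lerBlDr -lerBlDl ler_pdivlMr// ltW// mulrBl mul1r mulrC.
  exact: A_P.
Qed.
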